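(* Let $S$ be a countable inverse semigroup, let $X$ be a second-countable, zero-dimensional and locally compact Hausdorff space, let $R$ be a field, and let $\theta=(\{\theta_s\}_{s\in S},\{X_s\}_{s\in S})$ be a topological partial action of $S$ on $X$ with associated partial action $\alpha$ of $S$ on $\mathcal{L}_c(X)$. Then the skew inverse semigroup ring $\mathcal{L}_c(X)\rtimes_\alpha S$ is simple if, and only if, the following three conditions are satisfied: (1) $\theta$ is minimal; (2) $\theta$ is topologically principal; (3) for every non-zero ideal $\mathcal{I}$ of $\mathcal{L}_c(X)\rtimes_\alpha S$ there is some $\overline{f}\in\mathcal{I}$ such that $\operatorname{supp}(\widetilde\tau(\overline{f}))\neq\emptyset$.
   Context: An inverse semigroup is a semigroup $S$ such that each $s\in S$ has a unique $s^*\in S$ with $ss^*s=s$ and $s^*ss^*=s^*$. $E(S)$ is the set of idempotents, and $s\le t\iff s=ts^*s$. A space is zero-dimensional if it has a basis of compact-open subsets. A topological partial action of $S$ on a locally compact Hausdorff space $X$ is a collection of open sets $\{X_s\}_{s\in S}$ of $X$ and homeomorphisms $\{\theta_s:X_{s^*}\to X_s\}_{s\in S}$ such that for all $s,t\in S$: (i) $X=\bigcup_{e\in E(S)}X_e$; (ii) $\theta_s(X_{s^*}\cap X_t)=X_s\cap X_{st}$; (iii) $\theta_s(\theta_t(x))=\theta_{st}(x)$ for all $x\in X_{t^*}\cap X_{t^*s^*}$. A subset $U\subseteq X$ is invariant if $\theta_s(U\cap X_{s^*})\subseteq U$ for all $s\in S$; $\theta$ is minimal if there is no non-empty, proper, open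 invariant subset of $X$. With $S_x=\{s\in S\mid x\in X_{s^*}\}$, let $\Lambda(\theta)$ be the set of $x\in X$ such that for all $s\in S_x$, if $\theta_s(x)=x$ then there is $e\in E(S)$ with $e\le s$ and $x\in X_e$; $\theta$ is topologically principal if $\Lambda(\theta)$ is dense in $X$. $\mathcal{L}_c(X)$ is the commutative $R$-algebra of locally constant, compactly supported functions $X\to R$ with pointwise operations; $\operatorname{supp}(f)=\{x\mid f(x)\ne0\}$. For $s\in S$ let $D_s=\{f\in\mathcal{L}_c(X)\mid\operatorname{supp}(f)\subseteq X_s\}$, and $\alpha_s:D_{s^*}\to D_s$, $\alpha_s(f)(x)=f(\theta_{s^*}(x))$ if $x\in X_s$ and $0$ otherwise. This defines the partial action $\alpha$ of $S$ on the ring $\mathcal{L}_c(X)$ associated with $\theta$. Skew inverse semigroup ring: $\mathcal{L}$ is the associative ring of finite formal sums $\sum_s a_s\delta_s$, $a_s\in D_s$, with componentwise addition and multiplication determined by $(a_s\delta_s)(b_t\delta_t)=\alpha_s(\alpha_{s^*}(a_s)b_t)\delta_{st}$; $\mathcal{N}$ is the ideal of $\mathcal{L}$ generated by all $a\delta_r-a\delta_s$ with $r\le s$ and $a\in D_r$; $\mathcal{L}_c(X)\rtimes_\alpha S=\mathcal{L}/\mathcal{N}$, with $\overline{x}$ the class of $x$. The map $\widetilde\tau:\mathcal{L}_c(X)\rtimes_\alpha S\to\mathcal{L}_c(X)$, $\widetilde\tau(\overline{\sum_s a_s\delta_s})=\sum_s a_s$, is a well-defined additive map. A ring is simple if it has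 no non-zero proper two-sided ideal; ideals are two-sided. *)

(* Defs.v *)
From HB Require Import structures.
From mathcomp Require Import all_boot all_order all_algebra finmap.
From mathcomp Require Import all_classical topology.
From mathcomp Require Import monalg.

Set Implicit Arguments.
Unset Strict Implicit.
Unset Printing Implicit Defensive.

Import GRing.Theory.

Local Open Scope classical_set_scope.
Local Open Scope quotient_scope.
Local Open Scope ring_scope.

HB.mixin Record Semigroup_isInverse S of Semigroup S := {
  star : S -> S;
  mul_star_mul : forall s : S, (s * star s * s)%g = s;
  star_mul_star : forall s : S, (star s * s * star s)%g = star s;
  star_unique : forall s t : S,
    (s * t * s)%g = s -> (t * s * t)%g = t -> t = star s
}.

#[short(type="inverseSemigroupType")]
HB.structure Definition InverseSemigroup :=
  { S of Semigroup_isInverse S & Semigroup S }.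

Definition idempotents (S : inverseSemigroupType) : set S :=
  [set e | (e * e)%g = e].

Definition natural_le (S : inverseSemigroupType) (s t : S) : Prop :=
  s = (t * star s * s)%g.

Section InverseSemigroupTheory.
Variable S : inverseSemigroupType.
Implicit Types s t e f : S.
Local Open Scope group_scope.

Lemma star_star s : star (star s) = s.
Proof. by rewrite -(@star_unique _ (star s) s) ?star_mul_star ?mul_star_mul. Qed.

Lemma idem_star e : idempotents e -> star e = e.
Proof. by move=> /= ee; rewrite -(@star_unique _ e e) ?ee. Qed.

Lemma idem_mul_star s : idempotents (s * star s).
Proof. by rewrite /idempotents /= mulgA mul_star_mul. Qed.

Lemma idem_star_mul s : idempotents (star s * s).
Proof. by rewrite /idempotents /= mulgA star_mul_star. Qed.

Lemma idem_mul e f : idempotents e -> idempotents f -> idempotents (e * f).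
Proof.
move=> /= ee ff; set x := star (e * f).
have xE : x = f * x * e.
  apply/esym/star_unique.
    transitivity (e * f * x * (e * f)); last exact: mul_star_mul.
    by rewrite !mulgA -(mulgA e f f) ff -(mulgA _ e e) ee.
  transitivity (f * (x * (e * f) * x) * e); last by rewrite star_mul_star.
  by rewrite !mulgA -(mulgA _ e e) ee -(mulgA _ f f) ff.
have xx : idempotents x.
  rewrite /idempotents /= {1 2}xE.
  transitivity (f * (x * (e * f) * x) * e); first by rewrite !mulgA.
  by rewrite star_mul_star -xE.
by have := idem_star xx; rewrite /x star_star => efE; rewrite efE.
Qed.

Lemma idem_mulC e f : idempotents e -> idempotents f -> e * f = f * e.
Proof.
move=> ee ff; have efi := idem_mul ee ff; have fei := idem_mul ff ee.
rewrite -[LHS](idem_star efi); apply/esym/star_unique.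
  transitivity (e * (f * f) * (e * e) * f); first by rewrite !mulgA.
  by rewrite ee ff -mulgA; move: efi; rewrite /idempotents /= mulgA.
transitivity (f * (e * e) * (f * f) * e); first by rewrite !mulgA.
by rewrite ee ff -mulgA; move: fei; rewrite /idempotents /= mulgA.
Qed.

Lemma starM s t : star (s * t) = star t * star s.
Proof.
have C := idem_mulC (idem_mul_star t) (idem_star_mul s).
apply/esym/star_unique.
  transitivity (s * (t * star t * (star s * s)) * t); first by rewrite !mulgA.
  by rewrite C !mulgA mul_star_mul -!mulgA [t * (_ * _)]mulgA mul_star_mul.
transitivity (star t * (star s * s * (t * star t)) * star s).
  by rewrite !mulgA.
by rewrite -C !mulgA star_mul_star -!mulgA [star s * (_ * _)]mulgA star_mul_star.
Qed.

Lemma natural_leE s t : natural_le s t -> s * star s * t = s.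
Proof.
move=> st; have [f ff sE] : exists2 f, idempotents f & s = t * f.
  by exists (star s * s); [exact: idem_star_mul|rewrite mulgA].
have fC := idem_mulC ff (idem_star_mul t).
rewrite {1 2}sE starM (idem_star ff).
transitivity (t * (f * f) * star t * t); first by rewrite !mulgA.
by rewrite ff -!mulgA fC !mulgA mul_star_mul -sE.
Qed.

Lemma natural_le_mul2r s t u : natural_le s t -> natural_le (s * u) (t * u).
Proof.
rewrite /natural_le => st; rewrite starM.
have C := idem_mulC (idem_star_mul s) (idem_mul_star u).
transitivity (t * (u * star u * (star s * s)) * u); last by rewrite !mulgA.
by rewrite -C !mulgA -st -!mulgA [u * (_ * _)]mulgA mul_star_mul.
Qed.

Lemma natural_le_mul2l s t u : natural_le s t -> natural_le (u * s) (u * t).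
Proof.
rewrite /natural_le => st; rewrite starM.
have C := idem_mulC (idem_star_mul u) (idem_mul_star s).
have E : t * star s * (star u * u) * s = star u * u * s.
  rewrite -{1}(star_mul_star s).
  transitivity (t * star s * s * (star s * (star u * u) * s)).
    by rewrite !mulgA.
  rewrite -st; transitivity (s * star s * (star u * u) * s).
    by rewrite !mulgA.
  by rewrite -C -!mulgA (mulgA s) mul_star_mul.
transitivity (u * (t * star s * (star u * u) * s)); last by rewrite !mulgA.
by rewrite E !mulgA mul_star_mul.
Qed.

End InverseSemigroupTheory.

HB.mixin Record Zmodule_isRng A of GRing.Zmodule A := {
  rmul : A -> A -> A;
  rmulA : associative rmul;
  rmulDl : left_distributive rmul +%R;
  rmulDr : right_distributive rmul +%R
}.

#[short(type="rngType")]
HB.structure Definition Rng := { A of Zmodule_isRng A & GRing.Zmodule A }.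

Notation "x ** y" := (rmul x y) (at level 40, left associativity) : ring_scope.

Definition ideal (A : rngType) (I : set A) : Prop :=
  [/\ I 0,
      forall x y, I x -> I y -> I (x - y),
      forall a x, I x -> I (a ** x) &
      forall a x, I x -> I (x ** a)].

Definition simple_rng (A : rngType) : Prop :=
  ~ exists I : set A, [/\ ideal I, I <> [set 0] & I <> setT].

Lemma ideal_smallest (A : rngType) (G : set A) : ideal (smallest (@ideal A) G).
Proof.
split=> [J [[]]//|x y Ix Iy J JG|a x Ix J JG|a x Ix J JG].
- by have [[_ JB _ _] _] := JG; apply: JB; [apply: Ix|apply: Iy].
- by have [[_ _ Jl _] _] := JG; apply: Jl; apply: Ix.
- by have [[_ _ _ Jr] _] := JG; apply: Jr; apply: Ix.
Qed.

Lemma rmul0 (A : rngType) (x : A) : x ** 0 = 0.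
Proof. by apply: (@addIr _ (x ** 0)); rewrite -rmulDr !add0r. Qed.

Lemma rmulN (A : rngType) (x y : A) : x ** - y = - (x ** y).
Proof. by apply: (@addIr _ (x ** y)); rewrite -rmulDr !addNr rmul0. Qed.

Lemma rmul0l (A : rngType) (x : A) : 0 ** x = 0.
Proof. by apply: (@addIr _ (0 ** x)); rewrite -rmulDl !add0r. Qed.

Lemma rmulNl (A : rngType) (x y : A) : - x ** y = - (x ** y).
Proof. by apply: (@addIr _ (x ** y)); rewrite -rmulDl !addNr rmul0l. Qed.

Section QuotientRng.
Variables (A : rngType) (I : set A) (hI : ideal I).

Definition ideal_pred (_ : ideal I) : A -> bool := fun x => `[< I x >].

Fact ideal_pred_zmod : zmod_closed (ideal_pred hI).
Proof.
have [I0 IB _ _] := hI; split; first exact/asboolP.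
by move=> x y /asboolP Ix /asboolP Iy; apply/asboolP; apply: IB.
Qed.

HB.instance Definition _ :=
  GRing.isZmodClosed.Build A (ideal_pred hI) ideal_pred_zmod.

Definition rng_quot : Type :=
  @Quotient.quot A (GRing.ZmodClosed.clone A (ideal_pred hI) _).

HB.instance Definition _ := GRing.Zmodule.on rng_quot.
HB.instance Definition _ := EqQuotient.on rng_quot.

Definition rng_class (x : A) : rng_quot := \pi_(rng_quot) x.

Lemma rng_classP x y : rng_class x = rng_class y <-> I (x - y).
Proof.
rewrite /rng_class; split=> [/eqP|Ixy].
  by rewrite -Quotient.idealrBE => /asboolP.
by apply/eqP; rewrite -Quotient.idealrBE; apply/asboolP.
Qed.

Lemma rng_class_repr (x : rng_quot) : rng_class (repr x) = x.
Proof. exact: reprK. Qed.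

Lemma rng_classD x y : rng_class (x + y) = rng_class x + rng_class y.
Proof. exact: Quotient.pi_add. Qed.

Definition rng_quot_mul (x y : rng_quot) : rng_quot :=
  rng_class (repr x ** repr y).

Lemma rng_classM x y :
  rng_class (x ** y) = rng_quot_mul (rng_class x) (rng_class y).
Proof.
have [I0 IB Il Ir] := hI; apply/rng_classP.
have ID u v : I u -> I v -> I (u + v).
  by move=> Iu Iv; rewrite -[v]opprK; apply: (IB) => //; rewrite -sub0r; exact: IB.
set x' := repr _; set y' := repr _.
have -> : x ** y - x' ** y' = (x - x') ** y + x' ** (y - y').
  by rewrite rmulDl rmulDr rmulN rmulNl addrA addrNK.
by apply: ID; [apply: Ir|apply: Il];
  apply/rng_classP; rewrite rng_class_repr.
Qed.

Fact rng_quot_mulA : associative rng_quot_mul.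
Proof.
move=> x y z; rewrite -[x]rng_class_repr -[y]rng_class_repr -[z]rng_class_repr.
by rewrite -!rng_classM rmulA.
Qed.

Fact rng_quot_mulDl : left_distributive rng_quot_mul +%R.
Proof.
move=> x y z; rewrite -[x]rng_class_repr -[y]rng_class_repr -[z]rng_class_repr.
by rewrite -rng_classD -!rng_classM -rng_classD rmulDl.
Qed.

Fact rng_quot_mulDr : right_distributive rng_quot_mul +%R.
Proof.
move=> x y z; rewrite -[x]rng_class_repr -[y]rng_class_repr -[z]rng_class_repr.
by rewrite -rng_classD -!rng_classM -rng_classD rmulDr.
Qed.

HB.instance Definition _ := Zmodule_isRng.Build rng_quot
  rng_quot_mulA rng_quot_mulDl rng_quot_mulDr.

End QuotientRng.

(* The library's [zero_dimensional] asks for separation of points by clopen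
   sets, which is a different notion. *)
Definition has_compact_open_basis (X : topologicalType) : Prop :=
  exists2 B : set (set X), basis B & B `<=` [set U | compact U /\ open U].

Definition homeomorphism_on (X Y : topologicalType) (A : set X) (B : set Y)
    (f : X -> Y) : Prop :=
  {within A, continuous f} /\
  exists g : Y -> X,
    [/\ {within B, continuous g}, set_fun A B f, set_fun B A g,
        (forall x, A x -> g (f x) = x) & (forall y, B y -> f (g y) = y)].

(* The partially defined map theta_s : X_{s^*} -> X_s is encoded by a total
   function [pact s], whose values outside of [pdom (star s)] are irrelevant. *)
Record partial_action (S : inverseSemigroupType) (X : topologicalType) := {
  pdom : S -> set X;
  pact : S -> X -> X;
  pdom_open : forall s, open (pdom s);
  pact_homeo : forall s, homeomorphism_on (pdom (star s)) (pdom s) (pact s);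
  pdom_cover : [set: X] = \bigcup_(e in @idempotents S) pdom e;
  pact_image : forall s t,
    pact s @` (pdom (star s) `&` pdom t) = pdom s `&` pdom (s * t)%g;
  pact_comp : forall s t x, (pdom (star t) `&` pdom (star t * star s)%g) x ->
    pact s (pact t x) = pact (s * t)%g x
}.

Section PartialAction.
Variables (S : inverseSemigroupType) (X : topologicalType).
Variable theta : partial_action S X.

Lemma pact_in s x : pdom theta (star s) x -> pdom theta s (pact theta s x).
Proof. by have [_ [g [_ fS _ _ _]]] := pact_homeo theta s; exact: fS. Qed.

Lemma pact_idem e x : idempotents e -> pdom theta e x -> pact theta e x = x.
Proof.
move=> ee ex; have eE := idem_star ee.
have := @pact_comp _ _ theta e e x; rewrite !eE ee => /(_ (conj ex ex)) efx.
have [_ [g [_ _ _ gK _]]] := pact_homeo theta e; rewrite eE in gK.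
rewrite -[RHS]gK// -efx gK //; have := @pact_in e x.
by rewrite eE; apply.
Qed.

Lemma pdom_mul_star s : pdom theta s `<=` pdom theta (s * star s)%g.
Proof.
move=> x sx; have [_ [g [_ _ gS _ gK]]] := pact_homeo theta s.
suff [] : (pdom theta s `&` pdom theta (s * star s)%g) x by [].
by rewrite -pact_image; exists (g x); [split; exact: gS|exact: gK].
Qed.

Lemma pact_star_in s x : pdom theta s x ->
  pdom theta (star s) (pact theta (star s) x).
Proof. by move=> sx; apply: pact_in; rewrite star_star. Qed.

Lemma pactK s x : pdom theta s x -> pact theta s (pact theta (star s) x) = x.
Proof.
move=> sx; rewrite pact_comp; last first.
  by rewrite star_star; split=> //; exact: pdom_mul_star.
by apply: pact_idem; [exact: idem_mul_star|exact: pdom_mul_star].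
Qed.

Lemma pdom_mul s t x : pdom theta s x ->
  pdom theta t (pact theta (star s) x) -> pdom theta (s * t)%g x.
Proof.
move=> sx tx; suff [] : (pdom theta s `&` pdom theta (s * t)%g) x by [].
rewrite -pact_image; exists (pact theta (star s) x); last exact: pactK.
by split=> //; exact: pact_star_in.
Qed.

Lemma pact_star_comp s t x : pdom theta s x ->
  pdom theta t (pact theta (star s) x) ->
  pact theta (star t) (pact theta (star s) x) = pact theta (star (s * t)%g) x.
Proof.
move=> sx tx; rewrite starM pact_comp// !star_star; split=> //.
exact: pdom_mul.
Qed.

Lemma pdom_le s t : natural_le s t -> pdom theta s `<=` pdom theta t.
Proof.
move=> st x sx; have e := idem_mul_star s; have ex := pdom_mul_star sx.
have : (pdom theta (s * star s)%g `&` pdom theta (s * star s * t)%g) x.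
  by split=> //; rewrite natural_leE.
rewrite -pact_image (idem_star e) => -[y [ey ty]].
by rewrite (pact_idem e ey) => <-.
Qed.

Lemma pact_star_le s t x : natural_le s t -> pdom theta s x ->
  pact theta (star s) x = pact theta (star t) x.
Proof.
move=> st sx; have e := idem_mul_star s; have ex := pdom_mul_star sx.
rewrite -{1}(natural_leE st) starM (idem_star e) -pact_comp.
  by rewrite (pact_idem e ex).
by rewrite star_star (idem_star e) natural_leE.
Qed.

Definition invariant (U : set X) : Prop :=
  forall s, pact theta s @` (U `&` pdom theta (star s)) `<=` U.

Definition minimal_action : Prop :=
  ~ exists U : set X, [/\ U <> set0, U <> setT, open U & invariant U].

Definition Lambda : set X :=
  [set x | forall s, pdom theta (star s) x -> pact theta s x = x ->
    exists e, [/\ idempotents e, natural_le e s & pdom theta e x]].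

Definition topologically_principal : Prop := dense Lambda.

End PartialAction.

Definition supp (X : Type) (R : nmodType) (f : X -> R) : set X :=
  [set x | f x <> 0].

Definition locally_constant (X : topologicalType) (Y : Type) (f : X -> Y) :=
  forall x, \forall y \near x, f y = f x.

(* The set [supp f] of a locally constant [f] is already closed, so its
   compactness is compactness of the closed support. *)
Definition Lc (X : topologicalType) (R : nmodType) : set (X -> R) :=
  [set f | locally_constant f /\ compact (supp f)].

Section SkewRing.
Variables (S : inverseSemigroupType) (X : topologicalType).
Variable theta : partial_action S X.
Variable R : fieldType.

Definition Dideal (s : S) : set (X -> R) :=
  [set f | @Lc X R f /\ supp f `<=` pdom theta s].

(* [alpha s] is the isomorphism Dideal (star s) -> Dideal s, as a total function
   on all maps X -> R. *)
Definition alpha (s : S) (f : X -> R) : X -> R :=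
  fun x => if `[< pdom theta s x >] then f (pact theta (star s) x) else 0.

(* The coefficient of (f delta_s)(g delta_t), for any t. *)
Definition skew_coef (s : S) (f g : X -> R) : X -> R :=
  alpha s (alpha (star s) f * g).


Lemma supp_closed (f : X -> R) : locally_constant f -> closed (supp f).
Proof.
move=> lf; rewrite -openC openE => x /contrapT fx.
have := lf x; rewrite /interior fx; by apply: filterS => y fy; exact.
Qed.

Lemma Lc_sub (f g : X -> R) : @Lc X R f -> locally_constant g ->
  supp g `<=` supp f -> @Lc X R g.
Proof.
move=> [lf cf] lg gf; split=> //.
exact: subclosed_compact (supp_closed lg) cf gf.
Qed.

Lemma D0 s : Dideal s 0.
Proof.
split; last by move=> x /=.
split; first by move=> x; near=> y.
rewrite (_ : supp _ = set0); first exact: compact0.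
by apply/seteqP; split=> x.
Unshelve. all: by end_near. Qed.

Lemma DB s f g : Dideal s f -> Dideal s g -> Dideal s (f - g).
Proof.
move=> [[lf cf] fs] [[lg cg] gs].
have sfg : supp (f - g) `<=` supp f `|` supp g.
  move=> x; rewrite /supp /= => fgx; apply: contrapT => /not_orP[/contrapT fx /contrapT gx].
  by apply: fgx; rewrite !fctE fx gx subr0.
have lfg : locally_constant (f - g).
  by move=> x; apply: filterS2 (lf x) (lg x) => y fy gy; rewrite !fctE fy gy.
split; last by move=> x /sfg[/fs|/gs].
split=> //; apply: subclosed_compact (supp_closed lfg) _ sfg.
exact: compactU.
Qed.

Lemma skew_coefE s f g x : Dideal s f ->
  skew_coef s f g x = f x * g (pact theta (star s) x).
Proof.
move=> [_ fs]; rewrite /skew_coef /alpha.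
case: asboolP => [sx|sx].
  rewrite fctE star_star asboolT; last exact: pact_star_in.
  by rewrite pactK.
have -> : f x = 0 by apply/eqP/negPn/negP => /eqP fx; apply: sx; exact: fs.
by rewrite mul0r.
Qed.

Lemma skew_coef_D s t f g : Dideal s f -> Dideal t g -> Dideal (s * t)%g (skew_coef s f g).
Proof.
move=> Df Dg; have [Lf fs] := Df; have [[lg _] gt] := Dg.
have hE x := skew_coefE g x Df.
have sub : supp (skew_coef s f g) `<=` supp f.
  by move=> x; rewrite /supp /= hE; apply: contra_not => ->; rewrite mul0r.
split; last first.
  move=> x hx; have fx := sub _ hx; apply: pdom_mul; first exact: fs.
  by apply: gt => gx; apply: hx; rewrite hE gx mulr0.
have [lf _] := Lf; apply: Lc_sub Lf _ sub => x.
have [fx|fx] := eqVneq (f x) 0.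
  by have := lf x; apply: filterS => y fy; rewrite !hE fy fx !mul0r.
have sx : pdom theta s x by apply: fs; exact/eqP.
have [+ _] := pact_homeo theta (star s); rewrite star_star.
rewrite continuous_open_subspace; last exact: pdom_open.
move=> /(_ x (mem_set sx)) cx.
have := cx _ (lg (pact theta (star s) x)) => gx.
by apply: filterS2 (lf x) gx => y fy gy; rewrite !hE fy gy.
Qed.

Lemma skew_coef_assoc s t f g h : Dideal s f -> Dideal t g ->
  skew_coef (s * t)%g (skew_coef s f g) h = skew_coef s f (skew_coef t g h).
Proof.
move=> Df Dg; apply/funext => x.
rewrite (skew_coefE _ _ (skew_coef_D Df Dg)) !(skew_coefE _ _ Df).
rewrite (skew_coefE _ _ Dg) mulrA.
have [->|fx] := eqVneq (f x) 0; first by rewrite !mul0r.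
have [->|gx] := eqVneq (g (pact theta (star s) x)) 0.
  by rewrite mulr0 !mul0r.
rewrite pact_star_comp//; first by case: Df => _; apply; exact/eqP.
by case: Dg => _; apply; exact/eqP.
Qed.

Lemma skew_coefDl s (f f' g : X -> R) :
  skew_coef s (f + f') g = skew_coef s f g + skew_coef s f' g.
Proof.
apply/funext => x; rewrite /skew_coef /alpha !fctE.
case: asboolP => _; last by rewrite addr0.
by case: asboolP => _; rewrite ?mulrDl ?mul0r ?addr0.
Qed.

Lemma skew_coefDr s (f g g' : X -> R) :
  skew_coef s f (g + g') = skew_coef s f g + skew_coef s f g'.
Proof.
apply/funext => x; rewrite /skew_coef /alpha !fctE.
by case: asboolP => _; rewrite ?mulrDr ?addr0.
Qed.

Lemma skew_coef0l s g : skew_coef s 0 g = 0.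
Proof. by apply: (addIr (skew_coef s 0 g)); rewrite -skew_coefDl !add0r. Qed.

Lemma skew_coef0r s f : skew_coef s f 0 = 0.
Proof. by apply: (addIr (skew_coef s f 0)); rewrite -skew_coefDr !add0r. Qed.

Definition skew_mul (a b : {malg (X -> R)[S]}) : {malg (X -> R)[S]} :=
  \sum_(s <- msupp a) \sum_(t <- msupp b)
    << skew_coef s a@_s b@_t *g (s * t)%g >>.

Lemma skew_mulEw (d e : {fset S}) a b :
    (msupp a `<=` d)%fset -> (msupp b `<=` e)%fset ->
  skew_mul a b = \sum_(s <- d) \sum_(t <- e)
    << skew_coef s a@_s b@_t *g (s * t)%g >>.
Proof.
move=> ad be; rewrite /skew_mul (big_fset_incl _ ad) /=.
  apply: eq_bigr => s _; apply: big_fset_incl => // t _ /mcoeff_outdom ->.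
  by rewrite skew_coef0r monalgU0.
move=> s _ /mcoeff_outdom ->; rewrite big1// => t _.
by rewrite skew_coef0l monalgU0.
Qed.

Lemma skew_mulDl a b c : skew_mul (a + b) c = skew_mul a c + skew_mul b c.
Proof.
have sub := msuppD_le a b; rewrite (skew_mulEw sub (fsubset_refl _)).
rewrite (skew_mulEw (fsubsetUl _ (msupp b)) (fsubset_refl (msupp c))).
rewrite (skew_mulEw (fsubsetUr (msupp a) _) (fsubset_refl (msupp c))).
rewrite -big_split; apply: eq_bigr => s _ /=.
rewrite -big_split; apply: eq_bigr => t _ /=.
by rewrite mcoeffD skew_coefDl monalgUD.
Qed.

Lemma skew_mulDr a b c : skew_mul c (a + b) = skew_mul c a + skew_mul c b.
Proof.
have sub := msuppD_le a b; rewrite (skew_mulEw (fsubset_refl _) sub).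
rewrite (skew_mulEw (fsubset_refl (msupp c)) (fsubsetUl _ (msupp b))).
rewrite (skew_mulEw (fsubset_refl (msupp c)) (fsubsetUr (msupp a) _)).
rewrite -big_split; apply: eq_bigr => s _ /=.
rewrite -big_split; apply: eq_bigr => t _ /=.
by rewrite mcoeffD skew_coefDr monalgUD.
Qed.

Lemma skew_mul0l a : skew_mul 0 a = 0.
Proof. by apply: (addIr (skew_mul 0 a)); rewrite -skew_mulDl !add0r. Qed.

Lemma skew_mul0r a : skew_mul a 0 = 0.
Proof. by apply: (addIr (skew_mul a 0)); rewrite -skew_mulDr !add0r. Qed.

Lemma skew_mulU s t f g :
  skew_mul << f *g s >> << g *g t >> = << skew_coef s f g *g (s * t)%g >>.
Proof.
rewrite (skew_mulEw (@msuppU_le _ _ s f) (@msuppU_le _ _ t g)).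
by rewrite !big_seq_fset1 !mcoeffUU.
Qed.

Lemma formal_ind (P : {malg (X -> R)[S]} -> Prop) :
  P 0 -> (forall a b, P a -> P b -> P (a + b)) ->
  (forall s f, Dideal s f -> P << f *g s >>) ->
  forall a, (forall s, Dideal s a@_s) -> P a.
Proof.
move=> P0 PD PU a Da; rewrite [a]monalgE; elim/big_ind : _ => // s _.
exact: PU.
Qed.

Lemma skew_mulA a b c :
  (forall s, Dideal s a@_s) -> (forall s, Dideal s b@_s) -> (forall s, Dideal s c@_s) ->
  skew_mul a (skew_mul b c) = skew_mul (skew_mul a b) c.
Proof.
move=> Da Db Dc; move: a Da; apply: formal_ind => [|a a' IH IH'|s f Df].
- by rewrite !skew_mul0l.
- by rewrite !skew_mulDl IH IH'.
move: b Db; apply: formal_ind => [|b b' IH IH'|t g Dg].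
- by rewrite !(skew_mul0l, skew_mul0r).
- by rewrite !(skew_mulDl, skew_mulDr) IH IH'.
move: c Dc; apply: formal_ind => [|c c' IH IH'|u h Dh].
- by rewrite !(skew_mul0l, skew_mul0r).
- by rewrite !(skew_mulDl, skew_mulDr) IH IH'.
by rewrite !skew_mulU mulgA skew_coef_assoc.
Qed.

(* Finite formal sums [\sum_s << a_s *g s >>] with [a_s] in [Dideal s], where
   [<< a *g s >>] stands for a delta_s. *)
Definition formal_sum_pred : {malg (X -> R)[S]} -> bool :=
  fun a => `[< forall s, Dideal s a@_s >].

Fact formal_sum_zmod : zmod_closed formal_sum_pred.
Proof.
split; first by apply/asboolP => s; rewrite mcoeff0; exact: D0.
move=> a b /asboolP Da /asboolP Db; apply/asboolP => s.
by rewrite mcoeffB; exact: DB.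
Qed.

HB.instance Definition _ :=
  GRing.isZmodClosed.Build {malg (X -> R)[S]} formal_sum_pred formal_sum_zmod.

Record formal_sum := FormalSum {
  formal_val :> {malg (X -> R)[S]};
  formal_valP : formal_val \in formal_sum_pred
}.

HB.instance Definition _ := [isSub for formal_val].
HB.instance Definition _ := [Choice of formal_sum by <:].
HB.instance Definition _ := [SubChoice_isSubZmodule of formal_sum by <:].

Lemma formal_coefP (a : formal_sum) s : Dideal s a@_s.
Proof. by have /asboolP := formal_valP a. Qed.

Fact formal_mul_subproof (a b : formal_sum) :
  skew_mul a b \in formal_sum_pred.
Proof.
rewrite /skew_mul; apply: rpred_sum => s _; apply: rpred_sum => t _.
apply/asboolP => u; rewrite mcoeffU; case: eqP => [<-|_]; last exact: D0.
exact: skew_coef_D (formal_coefP a s) (formal_coefP b t).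
Qed.

Definition formal_mul (a b : formal_sum) : formal_sum :=
  FormalSum (formal_mul_subproof a b).

Fact formal_mulA : associative formal_mul.
Proof.
move=> a b c; apply/val_inj.
by apply: skew_mulA => s; exact: formal_coefP.
Qed.

Fact formal_mulDl : left_distributive formal_mul +%R.
Proof. by move=> a b c; apply/val_inj; exact: skew_mulDl. Qed.

Fact formal_mulDr : right_distributive formal_mul +%R.
Proof. by move=> a b c; apply/val_inj; exact: skew_mulDr. Qed.

HB.instance Definition _ := Zmodule_isRng.Build formal_sum
  formal_mulA formal_mulDl formal_mulDr.

Definition skew_relator : set formal_sum :=
  [set x | exists r s (a : X -> R),
    [/\ natural_le r s, Dideal r a & formal_val x = << a *g r >> - << a *g s >>]].

Definition skew_N : set formal_sum := smallest (@ideal formal_sum) skew_relator.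

Definition skew_ring : rngType :=
  rng_quot (ideal_smallest skew_relator : ideal skew_N).

Definition skew_class (x : formal_sum) : skew_ring :=
  rng_class (ideal_smallest skew_relator) x.

Definition formal_tau (a : {malg (X -> R)[S]}) : X -> R :=
  \sum_(s <- msupp a) a@_s.

(* Defined on a chosen representative; [skew_tauE] below shows that the value
   does not depend on the choice. *)
Definition skew_tau (z : skew_ring) : X -> R :=
  formal_tau (repr z : formal_sum).

Lemma formal_tauEw (d : {fset S}) a : (msupp a `<=` d)%fset ->
  formal_tau a = \sum_(s <- d) a@_s.
Proof. by move=> ad; apply: big_fset_incl => // s _ /mcoeff_outdom. Qed.

Lemma formal_tauB a b : formal_tau (a - b) = formal_tau a - formal_tau b.
Proof.
rewrite (formal_tauEw (msuppB_le a b)) (formal_tauEw (fsubsetUl _ (msupp b))).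
rewrite (formal_tauEw (fsubsetUr (msupp a) _)) -sumrB.
by apply: eq_bigr => s _; rewrite mcoeffB.
Qed.

Lemma formal_tauU s f : formal_tau << f *g s >> = f.
Proof. by rewrite (formal_tauEw msuppU_le) big_seq_fset1 mcoeffUU. Qed.

Let subgroup (P : {malg (X -> R)[S]} -> Prop) :=
  [/\ P 0, forall a b, P a -> P b -> P (a - b) &
    forall r s a, natural_le r s -> Dideal r a -> P (<< a *g r >> - << a *g s >>)].

Let J : set formal_sum := [set x | forall P, subgroup P -> P (formal_val x)].

Let subgroupD P a b : subgroup P -> P a -> P b -> P (a + b).
Proof.
move=> [P0 PB _] Pa Pb; rewrite -[b]opprK; apply: (PB) => //.
by rewrite -sub0r; exact: PB.
Qed.

Let skew_mulBr a b c : skew_mul c (a - b) = skew_mul c a - skew_mul c b.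
Proof. by apply: (addIr (skew_mul c b)); rewrite -skew_mulDr !addrNK. Qed.

Let skew_mulBl a b c : skew_mul (a - b) c = skew_mul a c - skew_mul b c.
Proof. by apply: (addIr (skew_mul b c)); rewrite -skew_mulDl !addrNK. Qed.

Let J_ideal : ideal J.
Proof.
split=> [P []//|x y Jx Jy P sP|y x Jx P sP|y x Jx P sP].
- by have [_ PB _] := sP; apply: PB; [exact: Jx|exact: Jy].
- have [P0 PB PU] := sP.
  apply: (Jx (fun z => P (skew_mul y z))); split=> [|a b Pa Pb|r s a rs Da].
  + by rewrite skew_mul0r.
  + by rewrite skew_mulBr; exact: PB.
  move: (formal_val y) (formal_coefP y).
  apply: formal_ind => [|b c Pb Pc|t f Df].
  + by rewrite skew_mul0l.
  + by rewrite skew_mulDl; exact: subgroupD.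
  rewrite skew_mulBr !skew_mulU; apply: PU; first exact: natural_le_mul2l.
  exact: skew_coef_D.
- have [P0 PB PU] := sP.
  apply: (Jx (fun z => P (skew_mul z y))); split=> [|a b Pa Pb|r s a rs Da].
  + by rewrite skew_mul0l.
  + by rewrite skew_mulBl; exact: PB.
  move: (formal_val y) (formal_coefP y).
  apply: formal_ind => [|b c Pb Pc|t f Df].
  + by rewrite skew_mul0r.
  + by rewrite skew_mulDr; exact: subgroupD.
  rewrite skew_mulBl !skew_mulU.
  have -> : skew_coef s a f = skew_coef r a f.
    have Das : Dideal s a.
      case: Da => La ar; split=> //; apply: subset_trans ar _.
      exact: pdom_le.
    apply/funext => x'; rewrite !skew_coefE//.
    have [->|ax] := eqVneq (a x') 0; first by rewrite !mul0r.
    rewrite (pact_star_le rs)//; case: Da => _; apply; exact/eqP.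
  apply: PU; first exact: natural_le_mul2r.
  exact: skew_coef_D.
Qed.

Lemma skew_tauE (x : formal_sum) : skew_tau (skew_class x) = formal_tau x.
Proof.
have : skew_N (repr (skew_class x) - x).
  apply/(@rng_classP _ _ (ideal_smallest skew_relator)).
  exact: rng_class_repr.
move=> /(_ J (conj J_ideal _)) JN.
apply/eqP; rewrite -subr_eq0 -formal_tauB; apply/eqP.
apply: (JN _ (fun z => formal_tau z = 0)) => [y [r [s [a [rs Da yE]]]] P [_ _]|].
  by rewrite yE; exact.
split=> [|a b a0 b0|r s a _ _]; first by rewrite -(subrr 0) formal_tauB subrr.
  by rewrite formal_tauB a0 b0 subrr.
by rewrite formal_tauB !formal_tauU subrr.
Qed.

End SkewRing.

(* Main.v *)
(* In the skew ring, [a delta_s] acts on arbitrary functions X -> R by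
   F |-> a . (F o theta_{s^*}), and this kills N. For an invariant set U, the
   elements whose images are supported in U form an ideal containing N.
   If the ring is simple, taking for U a proper open invariant set contradicts
   simplicity, which gives minimality; taking U empty shows that the action is
   faithful. So when theta_{s^*} is the identity on a compact open V, the
   element 1_V delta_s - 1_V delta_{s s^*} lies in N, and the sum of the values
   at x of the coefficients a_t for which t lies above an idempotent e with
   x in X_e, which vanishes on N, shows that s itself has this property at every
   x in V. A Baire argument over the countable S then gives the density of
   Lambda.
   Conversely, let tau(a)(x) <> 0 with x in Lambda and a in the ideal. Some
   point y is such that the a_s(x) with theta_{s^*}(x) = y have a nonzero sum c;
   fix s0 with a_{s0}(x) <> 0 among them. Cutting a by small compact open sets
   around x and y and translating by s0^* leaves c 1_V delta_e modulo N, because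
   every s s0^* that survives fixes x and hence lies above an idempotent near x.
   Minimality moves 1_V delta_e everywhere, and compactness of supports
   concludes. *)
Require Import Defs.
From HB Require Import structures.
From mathcomp Require Import all_boot all_order all_algebra finmap.
From mathcomp Require Import all_classical topology.
From mathcomp Require Import monalg.

Set Implicit Arguments.
Unset Strict Implicit.
Unset Printing Implicit Defensive.

Import GRing.Theory.

Local Open Scope classical_set_scope.
Local Open Scope ring_scope.

(** * The natural order *)

Section NaturalOrder.
Variable S : inverseSemigroupType.
Implicit Types r s t e f : S.
Local Open Scope group_scope.

Lemma natural_leP s t :
  natural_le s t <-> exists2 f, idempotents f & s = t * f.
Proof.
split=> [st|[f ff ->]].
  by exists (star s * s); [exact: idem_star_mul|rewrite mulgA].
rewrite /natural_le starM (idem_star ff).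
transitivity (t * (f * (star t * t)) * f); last by rewrite !mulgA.
by rewrite (idem_mulC ff (idem_star_mul t)) !mulgA mul_star_mul -mulgA ff.
Qed.

Lemma natural_le_trans r s t :
  natural_le r s -> natural_le s t -> natural_le r t.
Proof.
move=> /natural_leP[e ee ->] /natural_leP[f ff ->]; apply/natural_leP.
by exists (f * e); [exact: idem_mul|rewrite mulgA].
Qed.

Lemma natural_le_mul_idemr s e : idempotents e -> natural_le (s * e) s.
Proof. by move=> ee; apply/natural_leP; exists e. Qed.

Lemma idem_conj s e : idempotents e -> idempotents (s * e * star s).
Proof.
move=> ee; rewrite /idempotents /=.
transitivity (s * (e * (star s * s)) * e * star s); first by rewrite !mulgA.
rewrite (idem_mulC ee (idem_star_mul s)) !mulgA mul_star_mul.
by rewrite -(mulgA s) ee.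
Qed.

(** An idempotent passes to the right by conjugation: [e s = s (s^* e s)]. *)
Lemma natural_le_mul_ideml s e : idempotents e -> natural_le (e * s) s.
Proof.
move=> ee; apply/natural_leP; exists (star s * e * s).
  by rewrite -{2}(star_star s); exact: idem_conj.
transitivity (s * star s * e * s); last by rewrite !mulgA.
by rewrite (idem_mulC (idem_mul_star s) ee) -!mulgA [s * (_ * _)]mulgA
  mul_star_mul.
Qed.

Lemma natural_le_star s t : natural_le s t -> natural_le (star s) (star t).
Proof.
move=> /natural_leP[f ff ->]; rewrite starM (idem_star ff).
exact: natural_le_mul_ideml.
Qed.

Lemma natural_le_idem_star e s : idempotents e ->
  natural_le e (star s) -> natural_le e s.
Proof.
by move=> ee /natural_le_star; rewrite star_star (idem_star ee).
Qed.

End NaturalOrder.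

(** * Compact open neighbourhoods and nested compact sets *)

Section CompactOpen.
Variable X : topologicalType.

Lemma compact_open_nbhs (x : X) (O : set X) : has_compact_open_basis X ->
  nbhs x O -> exists V, [/\ compact V, open V, V x & V `<=` O].
Proof.
move=> [B [_ Bx] Bco] xO; have [V [BV Vx] VO] := Bx x O xO.
by have [cV oV] := Bco V BV; exists V.
Qed.

(** If no point lay in every [V n], the increasing open complements would cover the compact [V 0];
    one of them would contain it, leaving some [V N] empty. *)
Lemma nested_compact_nonempty (V : nat -> set X) :
    (forall n, closed (V n)) -> compact (V 0%N) ->
    (forall n, V n.+1 `<=` V n) -> (forall n, V n !=set0) ->
  exists x, forall n, V n x.
Proof.
move=> Vcl Vcpt Vdec Vne.
have Vmono m n : (m <= n)%N -> V n `<=` V m.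
  by elim: n => [|n IH]; [rewrite leqn0 => /eqP ->|
    rewrite leq_eqVlt => /predU1P[->//|/IH Vnm]; apply: subset_trans Vnm].
apply: contrapT => /forallNP noX.
have : \forall n \near \oo, V 0%N `<=` [set x | ~ V n x].
  have /compact_near_coveringP := Vcpt.
  apply=> x _; have /existsNP[m Vmx] := noX x.
  have oC : open (~` V m) by rewrite openC.
  exists (~` V m, [set n | (m <= n)%N]) => /=.
    by split; [exact: open_nbhs_nbhs|exact: nbhs_infty_ge].
  by move=> [y n] /= [Vmy mn] Vny; apply: Vmy; exact: Vmono Vny.
move=> [N _ /(_ N (leqnn N)) NV].
have [x VNx] := Vne N; apply: (NV x) => //.
exact: Vmono VNx.
Qed.

End CompactOpen.

(** * Ideals and finite sums in possibly non-unital rings *)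

Section IdealTheory.
Variables (A : rngType) (I : set A) (hI : ideal I).

Lemma idealN x : I x -> I (- x).
Proof. by have [I0 IB _ _] := hI => Ix; rewrite -sub0r; exact: IB. Qed.

Lemma idealD x y : I x -> I y -> I (x + y).
Proof.
have [_ IB _ _] := hI => Ix /idealN Iy.
by rewrite -(opprK y); exact: IB.
Qed.

Lemma ideal_sum (J : Type) (r : seq J) (P : pred J) (F : J -> A) :
  (forall j, P j -> I (F j)) -> I (\sum_(j <- r | P j) F j).
Proof.
have [I0 _ _ _] := hI => IF.
by elim/big_ind : _ => // x y; exact: idealD.
Qed.

Lemma ideal_subE x y : I (x - y) -> I x <-> I y.
Proof.
have [_ IB _ _] := hI => Ixy; split=> [Ix|Iy].
  by rewrite -(subKr x y); exact: IB.
by rewrite -(subrK y x); exact: idealD.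
Qed.

End IdealTheory.

Lemma rmul_suml (A : rngType) (J : Type) (r : seq J) (F : J -> A) (x : A) :
  (\sum_(j <- r) F j) ** x = \sum_(j <- r) F j ** x.
Proof. by apply: (big_morph (rmul^~ x)) => [u v|]; rewrite ?rmulDl ?rmul0l. Qed.

Lemma rmul_sumr (A : rngType) (J : Type) (r : seq J) (F : J -> A) (x : A) :
  x ** (\sum_(j <- r) F j) = \sum_(j <- r) x ** F j.
Proof. by apply: (big_morph (rmul x)) => [u v|]; rewrite ?rmulDr ?rmul0. Qed.

Lemma simple_rngP (A : rngType) (I : set A) :
  simple_rng A -> ideal I -> I = [set 0] \/ I = setT.
Proof.
move=> sA hI; apply: contrapT => /not_orP[I0 IT].
by apply: sA; exists I.
Qed.

(** * Formal sums, and their action on functions *)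

Section FormalSums.
Variables (S : inverseSemigroupType) (X : topologicalType).
Variables (R : fieldType) (theta : partial_action S X).
Notation L := (formal_sum theta R).
Notation N := (@skew_N S X theta R).
Implicit Types (r s t : S) (f g : X -> R) (a b : L).

(* Equal to 0 unless [f] lies in [Dideal theta s]. *)
Definition delta s f : L := insubd 0 << f *g s >>.

Lemma delta_val s f : Dideal theta s f -> formal_val (delta s f) = << f *g s >>.
Proof.
move=> Df; apply: (@insubdK _ _ L); apply/asboolP => t; rewrite mcoeffU.
by case: eqP => [<-//|_]; exact: D0.
Qed.

Lemma deltaM s t f g : Dideal theta s f -> Dideal theta t g ->
  delta s f ** delta t g = delta (s * t)%g (skew_coef theta s f g).
Proof.
move=> Df Dg; apply: val_inj.
transitivity (skew_mul theta (delta s f) (delta t g)); first by [].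
by rewrite /= !delta_val ?skew_mulU//; exact: skew_coef_D.
Qed.

Lemma formal_valB a b : formal_val (a - b) = formal_val a - formal_val b.
Proof. exact: (raddfB (\val : L -> _)). Qed.

Lemma deltaB s f g : Dideal theta s f -> Dideal theta s g ->
  delta s (f - g) = delta s f - delta s g.
Proof.
move=> Df Dg; apply: val_inj; rewrite /= [RHS]formal_valB.
rewrite !delta_val ?raddfB//; exact: DB.
Qed.

Lemma delta0 s : delta s 0 = 0.
Proof. by rewrite -(subrr 0) deltaB ?subrr//; exact: D0. Qed.

Lemma formal_sumE a : a = \sum_(s <- msupp a) delta s a@_s.
Proof.
apply: val_inj; rewrite raddf_sum /= [LHS]monalgE; apply: eq_bigr => s _.
by rewrite delta_val//; exact: formal_coefP.
Qed.

Lemma Dideal_le r s f : natural_le r s -> Dideal theta r f -> Dideal theta s f.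
Proof.
by move=> rs [Lf fr]; split=> //; apply: subset_trans fr _; exact: pdom_le.
Qed.

Lemma skew_relatorP (x : L) : skew_relator x <-> exists r s f,
  [/\ natural_le r s, Dideal theta r f & x = delta r f - delta s f].
Proof.
split=> -[r [s [f [rs Df xE]]]]; exists r, s, f; split=> //;
  have Dsf := Dideal_le rs Df.
  by apply: val_inj; rewrite /= [RHS]formal_valB !delta_val.
by rewrite xE formal_valB !delta_val.
Qed.

Lemma skew_N_delta r s f : natural_le r s -> Dideal theta r f ->
  skew_N (delta r f - delta s f).
Proof.
move=> rs Df; apply: sub_gen_smallest.
by apply/skew_relatorP; exists r, s, f.
Qed.

Lemma ideal_delta_le (I : set L) r s f : ideal I -> N `<=` I ->
  natural_le r s -> Dideal theta r f -> I (delta r f) <-> I (delta s f).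
Proof.
by move=> hI NI rs Df; apply: ideal_subE => //; apply: NI; exact: skew_N_delta.
Qed.

Definition subgroup (P : set L) := P 0 /\ forall a b, P a -> P b -> P (a - b).

Lemma subgroupD (P : set L) a b : subgroup P -> P a -> P b -> P (a + b).
Proof.
move=> [P0 PB] Pa Pb; rewrite -(opprK b); apply: (PB) => //.
by rewrite -sub0r; exact: PB.
Qed.

Lemma subgroup_formal (P : set L) a : subgroup P ->
  (forall s f, Dideal theta s f -> P (delta s f)) -> P a.
Proof.
move=> sP Pd; rewrite (formal_sumE a); elim/big_ind : _ => [|b c|s _].
- exact: sP.1.
- exact: subgroupD.
- by apply: Pd; exact: formal_coefP.
Qed.

(* The relators already generate [skew_N] as an additive group. *)
Lemma skew_N_sub (P : set L) : subgroup P ->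
    (forall r s f, natural_le r s -> Dideal theta r f ->
      P (delta r f - delta s f)) ->
  N `<=` P.
Proof.
move=> sP Prel.
(* [J] is the additive subgroup generated by the relators; it remains to see that it is an ideal. *)
pose J : set L := [set x | forall Q : set L, subgroup Q ->
  (forall r s f, natural_le r s -> Dideal theta r f ->
      Q (delta r f - delta s f)) -> Q x].
suff NJ : N `<=` J by move=> x /NJ; exact.
apply: smallest_sub => [|x /skew_relatorP[r [s [f [rs Df ->]]]] Q _]; last
  exact.
split=> [Q []//|x y Jx Jy Q sQ Qr|y x Jx|y x Jx] /=.
- by apply: sQ.2; [exact: Jx|exact: Jy].
- move=> Q sQ Qr; apply: (Jx [set z | Q (y ** z)]) => /=.
    split=> [|u v Qu Qv] /=; first by rewrite rmul0; exact: sQ.1.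
    by rewrite rmulDr rmulN; exact: sQ.2.
  move=> r s f rs Df; have Dsf := Dideal_le rs Df.
  apply: (@subgroup_formal [set y | Q (y ** (delta r f - delta s f))] y).
    split=> [|u v Qu Qv] /=; first by rewrite rmul0l; exact: sQ.1.
    by rewrite rmulDl rmulNl; exact: sQ.2.
  move=> t g Dg /=; rewrite rmulDr rmulN !deltaM//.
  by apply: Qr; [exact: natural_le_mul2l|exact: skew_coef_D].
- move=> Q sQ Qr; apply: (Jx [set z | Q (z ** y)]) => /=.
    split=> [|u v Qu Qv] /=; first by rewrite rmul0l; exact: sQ.1.
    by rewrite rmulDl rmulNl; exact: sQ.2.
  move=> r s f rs Df; have Dsf := Dideal_le rs Df.
  apply: (@subgroup_formal [set y | Q ((delta r f - delta s f) ** y)] y).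
    split=> [|u v Qu Qv] /=; first by rewrite rmul0; exact: sQ.1.
    by rewrite rmulDr rmulN; exact: sQ.2.
  move=> t g Dg /=; rewrite rmulDl rmulNl !deltaM//.
  (* On the support of [f], which lies in [X_r], the maps [theta_{r^*}] and [theta_{s^*}] agree. *)
  have -> : skew_coef theta s f g = skew_coef theta r f g.
    apply/funext => x'; rewrite !skew_coefE//.
    have [->|fx] := eqVneq (f x') 0; first by rewrite !mul0r.
    by rewrite (pact_star_le rs)//; apply: Df.2; exact/eqP.
  by apply: Qr; [exact: natural_le_mul2r|exact: skew_coef_D].
Qed.

(** Common form of [act_on] and [unit_sum]: for additive [Phi s], the additive map sending
    [delta s f] to [Phi s f]. *)
Definition formal_fold (V : zmodType) (Phi : S -> (X -> R) -> V) (a : L) : V :=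
  \sum_(s <- msupp a) Phi s a@_s.

Section Fold.
Variables (V : zmodType) (Phi : S -> (X -> R) -> V).
Hypothesis PhiB : forall s, {morph Phi s : f g / f - g}.

Let Phi0 s : Phi s 0 = 0.
Proof. by rewrite -[X in Phi s X](subrr 0) PhiB subrr. Qed.

Let fold_widen (d : {fset S}) a : (msupp a `<=` d)%fset ->
  formal_fold Phi a = \sum_(s <- d) Phi s a@_s.
Proof.
by move=> ad; apply: big_fset_incl => // s _ /mcoeff_outdom ->.
Qed.

Lemma formal_foldB : {morph formal_fold Phi : a b / a - b}.
Proof.
move=> a b; pose d := (msupp a `|` msupp b)%fset.
have sub : (msupp (formal_val (a - b)) `<=` d)%fset.
  by rewrite formal_valB; exact: msuppB_le.
rewrite (fold_widen sub) (@fold_widen d a) ?fsubsetUl//.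
rewrite (@fold_widen d b) ?fsubsetUr// -sumrB; apply: eq_bigr => s _.
by rewrite formal_valB mcoeffB PhiB.
Qed.

Lemma formal_fold0 : formal_fold Phi 0 = 0.
Proof. by rewrite -[X in _ Phi X](subrr 0) formal_foldB subrr. Qed.

Lemma formal_fold_delta s f : Dideal theta s f ->
  formal_fold Phi (delta s f) = Phi s f.
Proof.
move=> Df; rewrite (@fold_widen [fset s]%fset); last first.
  by rewrite delta_val//; exact: msuppU_le.
by rewrite big_seq_fset1 delta_val// mcoeffUU.
Qed.

Lemma subgroup_formal_fold (P : set V) : P 0 ->
  (forall u v, P u -> P v -> P (u - v)) ->
  subgroup [set a | P (formal_fold Phi a)].
Proof.
move=> P0 PB; split=> [|a b Pa Pb] /=; first by rewrite formal_fold0.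
by rewrite formal_foldB; exact: PB.
Qed.

End Fold.

(** The action of [a] on [F]. Since [F] is an arbitrary function, constants can serve as test
    functions. *)
Definition act_on F (a : L) : X -> R :=
  formal_fold (fun s f => skew_coef theta s f F) a.

Lemma skew_coefBl s F : {morph (fun f => skew_coef theta s f F) : f g / f - g}.
Proof.
by move=> f g; apply: (addIr (skew_coef theta s g F));
  rewrite -skew_coefDl !subrK.
Qed.

Lemma skew_coefBr s f : {morph skew_coef theta s f : F G / F - G}.
Proof.
by move=> F G; apply: (addIr (skew_coef theta s f G));
  rewrite -skew_coefDr !subrK.
Qed.

Lemma act_onB F : {morph act_on F : a b / a - b}.
Proof. by apply: formal_foldB => s; exact: skew_coefBl. Qed.

Lemma act_on0 F : act_on F 0 = 0.
Proof. by apply: formal_fold0 => s; exact: skew_coefBl. Qed.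

Lemma act_on_delta F s f : Dideal theta s f ->
  act_on F (delta s f) = skew_coef theta s f F.
Proof. by apply: formal_fold_delta => t; exact: skew_coefBl. Qed.

Lemma act_on_vecB a : {morph act_on^~ a : F G / F - G}.
Proof.
move=> F G; rewrite /act_on /formal_fold -sumrB.
by apply: eq_bigr => s _; exact: skew_coefBr.
Qed.

Lemma act_on_vec0 a : act_on 0 a = 0.
Proof. by rewrite -{1}(subrr 0) act_on_vecB subrr. Qed.

(** This is [skew_coef_assoc], whose last argument may be any function, extended additively in both
    factors. *)
Lemma act_onM F a b : act_on F (a ** b) = act_on (act_on F b) a.
Proof.
apply: (@subgroup_formal [set a | act_on F (a ** b) = act_on (act_on F b) a] a).
  split=> [|u v /= E E']; first by rewrite /= rmul0l !act_on0.
  by rewrite rmulDl rmulNl !act_onB E E'.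
move=> s f Df; apply: (@subgroup_formal [set b | act_on F (delta s f ** b) =
  act_on (act_on F b) (delta s f)] b).
  split=> [|u v /= E E']; first by rewrite /= rmul0 !act_on0 act_on_vec0.
  by rewrite rmulDr rmulN !act_onB act_on_vecB E E'.
move=> t g Dg /=; have Dfg := skew_coef_D Df Dg.
by rewrite deltaM// !act_on_delta// skew_coef_assoc.
Qed.

Lemma act_on_skew_N F a : skew_N a -> act_on F a = 0.
Proof.
move=> aN; apply: (@skew_N_sub [set a | act_on F a = 0] _ _ a aN).
  split=> [|u v /= E E']; first by rewrite /= act_on0.
  by rewrite act_onB E E' subrr.
move=> r s f rs Df /=; have Dsf := Dideal_le rs Df.
rewrite act_onB !act_on_delta//; apply/eqP; rewrite subr_eq0; apply/eqP.
apply/funext => x; rewrite !skew_coefE//.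
have [->|fx] := eqVneq (f x) 0; first by rewrite !mul0r.
by rewrite (pact_star_le rs)//; apply: Df.2; exact/eqP.
Qed.

(** For [U] empty this is the annihilator of the action on functions. *)
Definition range_ideal (U : set X) : set L :=
  [set a | forall F, supp (act_on F a) `<=` U].

(** If [f(x) F(theta_{s^*}(x))] is nonzero, then [theta_{s^*}(x)] lies in [U], and applying
    [theta_s] brings [x] back into [U]. *)
Lemma supp_act_on (U : set X) F a : Defs.invariant theta U -> supp F `<=` U ->
  supp (act_on F a) `<=` U.
Proof.
move=> iU FU; apply: (@subgroup_formal [set a | supp (act_on F a) `<=` U] a).
  split=> [|u v Eu Ev] /=; first by rewrite act_on0 => x.
  rewrite act_onB => x; rewrite /supp /= !fctE => uv.
  have [ux|/eqP/Eu//] := eqVneq (act_on F u x) 0.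
  by apply: Ev => vx; apply: uv; rewrite ux vx subrr.
move=> s f Df; rewrite /= act_on_delta// => x; rewrite /supp /= skew_coefE//.
move=> /eqP; rewrite mulf_eq0 negb_or => /andP[/eqP fx /eqP Fx].
have sx : pdom theta s x by exact: Df.2.
apply: (iU s); exists (pact theta (star s) x); last exact: pactK.
by split; [exact: FU|exact: pact_star_in].
Qed.

Lemma range_ideal_ideal U : Defs.invariant theta U -> ideal (range_ideal U).
Proof.
move=> iU; split=> [F|a b Ua Ub F|b a Ua F|b a Ua F].
- by rewrite act_on0 => x.
- rewrite act_onB => x; rewrite /supp /= !fctE => ab.
  have [ax|/eqP/Ua//] := eqVneq (act_on F a x) 0.
  by apply: (Ub F) => bx; apply: ab; rewrite ax bx subrr.
- by rewrite act_onM; apply: supp_act_on => //; exact: Ua.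
- by rewrite act_onM; exact: Ua.
Qed.

Lemma skew_N_range_ideal U : N `<=` range_ideal U.
Proof. by move=> a /act_on_skew_N aN F; rewrite aN => x. Qed.

Lemma range_ideal_delta U s f : Dideal theta s f ->
  range_ideal U (delta s f) <-> supp f `<=` U.
Proof.
move=> Df; split=> [Uf x fx|fU F x].
  (* Acting on the constant 1 returns [f] itself. *)
  apply: (Uf (fun=> 1)).
  by rewrite /supp /= act_on_delta// skew_coefE// mulr1.
rewrite act_on_delta// /supp /= skew_coefE// => fFx; apply: fU => fx.
by apply: fFx; rewrite fx mul0r.
Qed.

(** Ideals containing [N] correspond to ideals of the quotient, so simplicity can be used on formal
    sums. *)
Lemma simple_ideal (I : set L) : simple_rng (skew_ring theta R) ->
  ideal I -> N `<=` I -> I `<=` N \/ I = setT.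
Proof.
move=> sR hI NI; have [I0 IB Il Ir] := hI.
have hN := ideal_smallest (@skew_relator S X theta R).
pose cl : L -> skew_ring theta R := @skew_class S X theta R.
have clE a b : cl a = cl b <-> skew_N (a - b) by exact: rng_classP.
have clK z : cl (repr z) = z by exact: rng_class_repr.
have clI a : (cl @` I) (cl a) -> I a.
  move=> [b Ib /clE /NI ab]; exact/(ideal_subE hI ab).
have hcl : ideal (cl @` I).
  have cl0 : cl 0 = 0.
    by apply: (addIr (cl 0)); rewrite -rng_classD !add0r.
  have clN a : cl (- a) = - cl a.
    by apply: (addIr (cl a)); rewrite -rng_classD !addNr.
  split; first by exists 0.
  - move=> _ _ [a Ia <-] [b Ib <-]; rewrite -clN -rng_classD.
    by exists (a - b) => //; exact: IB.
  - move=> y _ [a Ia <-]; rewrite -(clK y).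
    exists (repr y ** a); [exact: Il|exact: rng_classM].
  - move=> y _ [a Ia <-]; rewrite -(clK y).
    exists (a ** repr y); [exact: Ir|exact: rng_classM].
have [E|E] := simple_rngP sR hcl; [left => a Ia|right].
  have : [set 0] (cl a) by rewrite -E; exists a.
  have : [set 0] (cl 0) by rewrite -E; exists 0.
  by move=> /= <- /clE; rewrite subr0.
by apply/seteqP; split=> // a _; apply: clI; rewrite E.
Qed.

End FormalSums.

(** * Consequences of simplicity *)

(** Baire argument: a decreasing sequence of compact open sets avoids the [A t] one after another,
    and its intersection is nonempty. *)
Lemma compact_open_baire (X : topologicalType) (T : Type) (A : T -> set X) :
    has_compact_open_basis X -> hausdorff_space X -> countable [set: T] ->
    (forall t O, open O -> O !=set0 -> exists V,
      [/\ compact V, open V, V !=set0, V `<=` O & forall x, V x -> ~ A t x]) ->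
  dense [set x | forall t, ~ A t x].
Proof.
move=> Xb Xh /countable_injP[i iinj] Astep O [x0 Ox0] oO.
pose co (V : set X) := [/\ compact V, open V & V !=set0].
(* Stage [n] avoids the [A t] with [i t = n], and keeps [V] if there is no such [t]. Placing [co]
   under the existential makes the step total, as [choice] requires. *)
have step (nV : nat * set X) : exists V', co nV.2 ->
    [/\ co V', V' `<=` nV.2 &
      forall t, i t = nV.1 -> forall x, V' x -> ~ A t x].
  case: nV => n V /=.
  have [[t itn]|noT] := pselect (exists t, i t = n); last first.
    by exists V => coV; split=> // t itn; case: noT; exists t.
  have [coV|ncoV] := pselect (co V); last by exists V.
  have [cV oV V0] := coV; have [V' [cV' oV' V'0 V'V V'A]] := Astep t V oV V0.
  exists V' => _; split=> // t' it'n.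
  suff -> : t' = t by [].
  by apply: iinj; rewrite ?in_setT// itn.
have [nxt nxtP] := choice step.
have [V0 [cV0 oV0 V0x V0O]] :=
  compact_open_nbhs Xb (open_nbhs_nbhs (conj oO Ox0)).
pose V := fix V n := if n is m.+1 then nxt (m, V m) else V0.
have coV n : co (V n).
  elim: n => [|n IH] /=; first by split=> //; exists x0.
  by have [] := nxtP (n, V n) IH.
have [n|||n|x Vx] := @nested_compact_nonempty X V.
- by have [cVn _ _] := coV n; exact: compact_closed.
- exact: cV0.
- by move=> n; have [] := nxtP (n, V n) (coV n).
- by have [] := coV n.
exists x; split; first exact: V0O (Vx 0%N).
move=> t; have [_ _] := nxtP (i t, V (i t)) (coV (i t)).
by apply; [|exact: (Vx (i t).+1)].
Qed.

Section Simplicity.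
Variables (S : inverseSemigroupType) (X : topologicalType).
Variables (R : fieldType) (theta : partial_action S X).
Notation L := (formal_sum theta R).
Notation N := (@skew_N S X theta R).
Implicit Types (r s t e : S) (f g : X -> R) (a b : L) (V W : set X).

Lemma Dideal_mul s f g : locally_constant g -> Dideal theta s f ->
  Dideal theta s (g * f).
Proof.
move=> lg [[lf cf] fs].
have sgf : supp (g * f) `<=` supp f.
  by move=> x; rewrite /supp /= !fctE => gfx fx; apply: gfx; rewrite fx mulr0.
split; last exact: subset_trans fs.
apply: Lc_sub sgf => //; move=> x.
by apply: filterS2 (lg x) (lf x) => y; rewrite !fctE => -> ->.
Qed.

Definition ind V : X -> R := fun x => (x \in V)%:R.

Lemma indT V x : V x -> ind V x = 1.
Proof. by move=> Vx; rewrite /ind mem_set. Qed.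

Lemma indF V x : ~ V x -> ind V x = 0.
Proof. by move=> Vx; rewrite /ind memNset. Qed.

Lemma supp_ind V : supp (ind V) = V.
Proof.
apply/seteqP; split=> x; rewrite /supp /=; last first.
  by move=> Vx; rewrite indT//; apply/eqP; exact: oner_neq0.
by move=> Vx; apply: contrapT => /indF.
Qed.

Lemma ind_locally_constant V : hausdorff_space X -> compact V -> open V ->
  locally_constant (ind V).
Proof.
move=> Xh cV oV x; have [Vx|nVx] := pselect (V x).
  have : nbhs x V by exact: open_nbhs_nbhs.
  by apply: filterS => y Vy; rewrite !indT.
have : nbhs x (~` V).
  by apply: open_nbhs_nbhs; split=> //; rewrite openC; exact: compact_closed.
by apply: filterS => y Vy; rewrite !indF.
Qed.

Lemma Dideal_ind s V : hausdorff_space X -> compact V -> open V ->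
  V `<=` pdom theta s -> Dideal theta s (ind V).
Proof.
move=> Xh cV oV Vs; split; last by rewrite supp_ind.
by split; [exact: ind_locally_constant|rewrite supp_ind].
Qed.

Lemma pact_continuous_at s x : pdom theta (star s) x ->
  {for x, continuous (pact theta s)}.
Proof.
move=> sx; have [+ _] := pact_homeo theta s.
rewrite continuous_open_subspace; last exact: pdom_open.
by apply; exact: mem_set.
Qed.

Hypotheses (Xb : has_compact_open_basis X) (Xh : hausdorff_space X).

(** The domains of idempotents cover [X], so one of them contains a small compact open neighbourhood
    of [x]. *)
Lemma idempotent_bump x (O : set X) : nbhs x O -> exists V e,
  [/\ compact V, open V, V x, V `<=` O &
      idempotents e /\ Dideal theta e (ind V)].
Proof.
move=> xO; have : [set: X] x by [].
rewrite (pdom_cover theta) => -[e ee ex].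
have xe : nbhs x (pdom theta e).
  by apply: open_nbhs_nbhs; split=> //; exact: pdom_open.
have [V [cV oV Vx VOe]] := compact_open_nbhs Xb (filterI xO xe).
exists V, e; split=> //; first by move=> y /VOe[].
by split=> //; apply: Dideal_ind => // y /VOe[].
Qed.

Lemma invariant0 : Defs.invariant theta set0.
Proof. by move=> s _ [x [[]]]. Qed.

(** The range ideal of [U] is not inside [N], as it contains an indicator acting nontrivially; it is
    not everything, as that would put every point in [U]. *)
Lemma simple_minimal : simple_rng (skew_ring theta R) -> minimal_action theta.
Proof.
move=> sR [U [U0 UT oU iU]].
have [UN|UT'] := simple_ideal sR (range_ideal_ideal R iU)
    (@skew_N_range_ideal _ _ _ theta U).
  have /set0P[x Ux] : U != set0 by exact/eqP.
  have [V [e [_ _ Vx VU [_ De]]]] :=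
    idempotent_bump (open_nbhs_nbhs (conj oU Ux)).
  have /UN/(@skew_N_range_ideal _ _ _ _ set0) :
      range_ideal U (delta theta e (ind V)).
    by apply/range_ideal_delta => //; rewrite supp_ind.
  by move=> /(range_ideal_delta _ De); rewrite supp_ind => /(_ x Vx).
apply: UT; apply/seteqP; split=> // x _.
have [V [e [_ _ Vx _ [_ De]]]] := @idempotent_bump x setT filterT.
have : range_ideal U (delta theta e (ind V)) by rewrite UT'.
by move=> /(range_ideal_delta _ De); rewrite supp_ind; apply.
Qed.

(** The germ of [s] at [x] is a unit of the groupoid of germs. *)
Definition unit_germ x s : Prop :=
  exists e, [/\ idempotents e, natural_le e s & pdom theta e x].

(** If [e] witnesses the germ of [s] and [r = s f], then [r e = e f] is an idempotent below [r]; its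
    domain contains [x] because [theta_{r^*}] fixes [x]. *)
Lemma unit_germ_le x r s : natural_le r s -> pdom theta r x ->
  unit_germ x r <-> unit_germ x s.
Proof.
move=> rs rx; split=> -[e [ee le ex]].
  by exists e; split=> //; exact: natural_le_trans rs.
have /natural_leP[f ff rE] := rs.
exists (r * e)%g; split.
- have se : (s * e)%g = e.
    by rewrite {2}(le : e = s * star e * e)%g (idem_star ee) -mulgA ee.
  suff -> : (r * e)%g = (e * f)%g by exact: idem_mul.
  by rewrite rE -mulgA (idem_mulC ff ee) mulgA se.
- exact: natural_le_mul_idemr.
- apply: pdom_mul => //; rewrite (pact_star_le rs)// -(pact_star_le le)//.
  by rewrite (idem_star ee) pact_idem.
Qed.

(** The part of [formal_tau] at [x] carried by unit germs. Unlike the full sum, it can separate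
    [1_V delta_s] from [1_V delta_{s s^*}]. *)
Definition unit_sum x a : R :=
  formal_fold (fun s f => if `[< unit_germ x s >] then f x else 0) a.

Let unit_termB x s :
  {morph (fun f : X -> R => if `[< unit_germ x s >] then f x else 0) :
    f g / f - g}.
Proof. by move=> f g; case: ifP => _; rewrite ?fctE// subrr. Qed.

Lemma unit_sumB x : {morph unit_sum x : a b / a - b}.
Proof. by apply: formal_foldB => s; exact: unit_termB. Qed.

Lemma unit_sum_delta x s f : Dideal theta s f ->
  unit_sum x (delta theta s f) = if `[< unit_germ x s >] then f x else 0.
Proof.
exact: (formal_fold_delta (unit_termB x)).
Qed.

Lemma unit_sum_skew_N x a : skew_N a -> unit_sum x a = 0.
Proof.
move=> aN; apply: (@skew_N_sub _ _ _ _ [set a | unit_sum x a = 0] _ _ a aN).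
  apply: (@subgroup_formal_fold _ _ _ _ _ _ (unit_termB x) [set 0]) => //.
  by move=> u v -> ->; rewrite subrr.
move=> r s f rs Df /=; have Dsf := Dideal_le rs Df.
rewrite unit_sumB !unit_sum_delta//.
have [fx|/eqP fx] := eqVneq (f x) 0; first by rewrite fx !if_same subrr.
have rx : pdom theta r x by exact: Df.2.
by rewrite (asbool_equiv_eq (unit_germ_le rs rx)) subrr.
Qed.

(** For [t = s^*], the elements [1_V delta_t] and [1_V delta_{t t^*}] act alike, so simplicity puts
    their difference in [N]. There [unit_sum] vanishes; the second term contributes 1, hence so does
    the first. *)
Lemma simple_effective s V : simple_rng (skew_ring theta R) ->
    compact V -> open V -> V `<=` pdom theta (star s) ->
    (forall x, V x -> pact theta s x = x) ->
  forall x, V x -> unit_germ x s.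
Proof.
move=> sR cV oV Vs fixV x Vx; set t := star s; pose e := (t * star t)%g.
have ee : idempotents e by exact: idem_mul_star.
have Dt : Dideal theta t (ind V) by exact: Dideal_ind.
have De : Dideal theta e (ind V).
  by apply: Dideal_ind => //; apply: subset_trans Vs _; exact: pdom_mul_star.
have : skew_N (delta theta t (ind V) - delta theta e (ind V)).
  have [UN|UT] := simple_ideal sR (range_ideal_ideal R invariant0)
    (@skew_N_range_ideal _ _ _ theta set0).
    apply: UN => F; suff -> : act_on F (delta theta t (ind V) -
        delta theta e (ind V)) = 0 by move=> y.
    rewrite act_onB !act_on_delta//; apply/eqP; rewrite subr_eq0; apply/eqP.
    apply/funext => y; rewrite !skew_coefE//.
    have [Vy|Vy] := pselect (V y); last by rewrite indF// !mul0r.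
    rewrite star_star fixV// (idem_star ee) pact_idem//.
    by apply: De.2; rewrite supp_ind.
  (* The annihilator is not the whole ring, since [1_V delta_e] acts nontrivially. *)
  have : range_ideal set0 (delta theta e (ind V)) by rewrite UT.
  by move=> /(range_ideal_delta _ De); rewrite supp_ind => /(_ x Vx).
move=> /(unit_sum_skew_N x); rewrite unit_sumB !unit_sum_delta// indT//.
have ex : unit_germ x e.
  exists e; split=> //; last by apply: De.2; rewrite supp_ind.
  by apply/natural_leP; exists e.
rewrite (asboolT ex); case: asboolP => [[e' [ee' e't e'x]] _|_].
  by exists e'; split=> //; exact: natural_le_idem_star.
by rewrite sub0r => /eqP; rewrite oppr_eq0 oner_eq0.
Qed.

Lemma simple_topologically_principal : countable [set: S] ->
  simple_rng (skew_ring theta R) -> topologically_principal theta.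
Proof.
move=> Sc sR.
(* Fixed points of [theta_s] with a non-unit germ; [Lambda] is the complement of their union. *)
pose A s := [set x |
  [/\ pdom theta (star s) x, pact theta s x = x & ~ unit_germ x s]].
suff -> : topologically_principal theta = dense [set x | forall s, ~ A s x].
  apply: compact_open_baire => // s O oO [x0 Ox0]; apply: contrapT => noV.
  (* Otherwise [A s] is dense in [O], and by continuity [theta_s] fixes a whole compact open set
     around one of its points. *)
  have meet V : compact V -> open V -> V !=set0 -> V `<=` O -> V `&` A s !=set0.
    move=> cV oV V0 VO; apply: contrapT => VA; apply: noV; exists V; split=> //.
    by move=> x Vx Ax; apply: VA; exists x.
  have [V0 [cV0 oV0 V0x0 V0O]] :=
    compact_open_nbhs Xb (open_nbhs_nbhs (conj oO Ox0)).
  have [x [/V0O Ox [sx fx gx]]] := meet V0 cV0 oV0 (ex_intro _ x0 V0x0) V0O.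
  have oD := pdom_open theta (star s).
  have oOD : open (O `&` pdom theta (star s)) by exact: openI.
  have [V [cV oV Vx VOD]] :=
    compact_open_nbhs Xb (open_nbhs_nbhs (conj oOD (conj Ox sx))).
  apply: gx; apply: (simple_effective sR cV oV) => // y; first by move=> /VOD[].
  move=> Vy; apply/eqP/negPn/negP => sy.
  (* If [theta_s] moved [y], some neighbourhood [W] of [y] would be disjoint from its image and so
     miss [A s]. *)
  move: (Xh); rewrite open_hausdorff => /(_ _ _ sy).
  move=> [[P Q] [/set_mem/= Psy /set_mem/= Qy] [/= oP oQ PQ]].
  have [_ sDy] := VOD _ Vy.
  have nW : nbhs y (V `&` Q `&` pact theta s @^-1` P).
    do 2?[apply: filterI]; [exact: open_nbhs_nbhs|exact: open_nbhs_nbhs|].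
    by apply: (pact_continuous_at sDy); exact: open_nbhs_nbhs.
  have [W [cW oW Wy WV]] := compact_open_nbhs Xb nW.
  have [|z [Wz [_ sz _]]] := meet W cW oW (ex_intro _ y Wy).
    by move=> z /WV[[/VOD[]]].
  have [[_ Qz]] := WV _ Wz; rewrite /preimage /= sz => Pz.
  by move/eqP: PQ => /seteqP[+ _] => /(_ z (conj Pz Qz)).
rewrite /topologically_principal; congr dense; apply/seteqP; split=> x /=.
  by move=> Lx s [sx fx]; apply; exact: Lx.
by move=> nA s sx fx; apply: contrapT => ng; exact: (nA s).
Qed.

End Simplicity.

(** * Ideals on which tau does not vanish *)

Section Converse.
Variables (S : inverseSemigroupType) (X : topologicalType).
Variables (R : fieldType) (theta : partial_action S X).
Hypotheses (Xb : has_compact_open_basis X) (Xh : hausdorff_space X).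
Notation L := (formal_sum theta R).
Notation N := (@skew_N S X theta R).
Implicit Types (r s t e : S) (f g : X -> R) (a b : L) (V W : set X) (c : R).

Lemma skew_coef_idem e f g : idempotents e -> Dideal theta e f ->
  skew_coef theta e f g = f * g.
Proof.
move=> ee Df; apply/funext => x; rewrite skew_coefE// fctE.
have [->|/eqP fx] := eqVneq (f x) 0; first by rewrite !mul0r.
by rewrite (idem_star ee) pact_idem//; exact: Df.2.
Qed.

Lemma Dideal_cst c s f : Dideal theta s f -> Dideal theta s (cst c * f).
Proof. by apply: Dideal_mul => x; near=> y. Unshelve. all: by end_near. Qed.

Lemma Dideal_idem_mul e e' f : idempotents e -> Dideal theta e f ->
  Dideal theta e' f -> Dideal theta (e * e')%g f.
Proof.
move=> ee [Lf fe] [_ fe']; split=> // x fx; apply: pdom_mul; first exact: fe.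
by rewrite (idem_star ee) pact_idem; [exact: fe'| |exact: fe].
Qed.

Lemma delta_cst_sum e f (J : Type) (r : seq J) (c : J -> R) :
    Dideal theta e f ->
  \sum_(j <- r) delta theta e (cst (c j) * f) =
  delta theta e (cst (\sum_(j <- r) c j) * f).
Proof.
move=> Df; have Dc k := Dideal_cst k Df.
have E k k' : delta theta e (cst (k - k') * f) =
    delta theta e (cst k * f) - delta theta e (cst k' * f).
  by rewrite -deltaB// -mulrBl.
have E0 : delta theta e (cst 0 * f) = 0 by rewrite -(subrr 0) E subrr.
apply: (big_ind2 (fun (u : L) k => u = delta theta e (cst k * f))) => //.
by move=> _ k _ k' -> ->; rewrite -{2}(opprK k') E -(sub0r k') E E0 sub0r opprK.
Qed.

(** Near [x0] the coefficient is the constant [f x0]. If it is nonzero, an idempotent [e'] lies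
    below [t], and [e e'], which is below both [e t] and [e], links the two terms modulo [N]. *)
Lemma corner_term t x0 f : Dideal theta t f ->
    (f x0 <> 0 -> unit_germ theta x0 t) ->
  exists G, nbhs x0 G /\ forall V e, V `<=` G -> idempotents e ->
    Dideal theta e (ind R V) ->
    skew_N (delta theta e (ind R V) ** delta theta t f -
            delta theta e (cst (f x0) * ind R V)).
Proof.
move=> Df germ; have [_ NB _ _] := ideal_smallest (@skew_relator S X theta R).
pose G0 := [set x | f x = f x0].
have G0x0 : nbhs x0 G0 by exact: Df.1.1.
have kE V' e' : V' `<=` G0 -> idempotents e' -> Dideal theta e' (ind R V') ->
    delta theta e' (ind R V') ** delta theta t f =
    delta theta (e' * t)%g (cst (f x0) * ind R V').
  move=> VG ee DV; rewrite deltaM// skew_coef_idem//; congr delta.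
  apply/funext => x; rewrite !fctE mulrC.
  by have [/VG ->//|Vx] := pselect (V' x); rewrite indF// !mulr0.
have [fx0|/eqP/germ[e' [ee' e't e'x0]]] := eqVneq (f x0) 0.
  exists G0; split=> // V' e' VG ee DV; rewrite kE// fx0.
  have -> : cst 0 * ind R V' = 0 by apply/funext => x; rewrite !fctE mul0r.
  by rewrite !delta0 subrr => J [[]].
exists (G0 `&` pdom theta e'); split.
  by apply: filterI => //; apply: open_nbhs_nbhs; split=> //; exact: pdom_open.
move=> V' e1 VG ee DV; rewrite kE//; last by move=> x /VG[].
set k := _ * _.
have Dk : Dideal theta e1 k by exact: Dideal_cst.
have Dk' : Dideal theta (e1 * e')%g k.
  apply: Dideal_idem_mul => //; apply: Dideal_cst; split; first exact: DV.1.
  by rewrite supp_ind => x /VG[].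
rewrite -(subrKA (delta theta (e1 * e')%g k)) addrC.
rewrite -(opprB (delta _ (e1 * e')%g _) (delta _ (e1 * t)%g _)).
by apply: NB; apply: skew_N_delta => //;
  [exact: natural_le_mul_idemr|exact: natural_le_mul2l].
Qed.

(** Grouping the sum by values of [h], some fibre has nonzero sum and hence a nonzero term. *)
Lemma nonzero_fibre (F : S -> R) (h : S -> X) (d : {fset S}) :
    \sum_(s <- d) F s <> 0 -> exists s0,
  [/\ s0 \in d, F s0 <> 0 &
      \sum_(s <- d) (if h s == h s0 then F s else 0) <> 0].
Proof.
rewrite (partition_big_imfset _ h) /= => sum0; apply: contrapT => noS.
apply: sum0; rewrite big_seq big1// => y /imfsetP[s1 /= s1d ->].
have [//|/eqP cn0] := eqVneq (\sum_(s <- d | h s == h s1) F s) 0.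
have [s0 [s0d hs0 Fs0]] : exists s0, [/\ s0 \in d, h s0 = h s1 & F s0 <> 0].
  apply: contrapT => nos; apply: cn0; rewrite big_seq_cond big1// => s.
  move=> /andP[sd /eqP hs]; apply: contrapT => Fs.
  by apply: nos; exists s.
case: noS; exists s0; split=> //.
by under eq_bigr do rewrite hs0; rewrite -big_mkcond.
Qed.

Lemma corner_idempotent (I : set L) a x0 : ideal I -> N `<=` I -> I a ->
    Lambda theta x0 -> formal_tau a x0 <> 0 -> exists V e,
  [/\ compact V, open V, V x0, idempotents e /\ Dideal theta e (ind R V) &
      I (delta theta e (ind R V))].
Proof.
move=> hI NI Ia Lx0; rewrite /formal_tau fct_sumE => tau0.
pose h s := pact theta (star s) x0.
have [s0 [s0a as0 sum0]] := nonzero_fibre h tau0.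
have [[_ IB Il Ir] Dc] := (hI, fun s => formal_coefP a s).
have s0x0 : pdom theta s0 x0 by exact: (Dc s0).2.
(* [W] must separate [h s0] from the finitely many other values [h s], so that the right factor
   [1_W delta_{s0^*}] kills the other fibres at [x0]. *)
have nW : nbhs (h s0) (pdom theta (star s0) `&`
    \bigcap_(s in [set` msupp a]) [set z | h s <> h s0 -> z <> h s]).
  apply: filterI.
    by apply: open_nbhs_nbhs; split; [exact: pdom_open|exact: pact_star_in].
  apply: filter_bigI => s sa.
  have [hs|hs] := eqVneq (h s) (h s0); first by apply: filterE => z.
  have : nbhs (h s0) (~` [set h s]).
    apply: open_nbhs_nbhs; split; last by move=> /esym/eqP; exact/negP.
    rewrite openC; apply: accessible_closed_set1; exact: hausdorff_accessible.
  by apply: filterS => z /= zs _.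
have [W [cW oW Wx WO]] := compact_open_nbhs Xb nW.
have Dq : Dideal theta (star s0) (ind R W) by apply: Dideal_ind => // z /WO[].
pose k s := skew_coef theta s a@_s (ind R W).
have Dk s : Dideal theta (s * star s0)%g (k s) by exact: skew_coef_D.
have kx0 s : s \in msupp a -> k s x0 = if h s == h s0 then a@_s x0 else 0.
  move=> sa; rewrite /k skew_coefE// -/(h s).
  have [->|hs] := eqVneq (h s) (h s0); first by rewrite indT// mulr1.
  rewrite indF ?mulr0// => /WO[_ /(_ s sa)] /=; apply=> //; exact/eqP.
have germ s : k s x0 <> 0 -> unit_germ theta x0 (s * star s0)%g.
  move=> ks; have sa : s \in msupp a.
    apply: contrapT => /negP/mcoeff_outdom as0'; apply: ks.
    by rewrite /k as0' skew_coef0l.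
  have tx0 := (Dk s).2 _ ks.
  have sx0 : pdom theta s x0.
    by apply: (Dc s).2 => asx; apply: ks; rewrite /k skew_coefE// asx mul0r.
  have hs : h s = h s0.
    by apply: contrapT => /eqP hs; apply: ks; rewrite kx0// (negbTE hs).
  have sx : pdom theta (star s0) (h s) by rewrite hs; exact: pact_star_in.
  (* [Lambda] is applied to the inverse of [s s0^*], whose map sends [x0] to [h s = h s0] and back
     to [x0]. *)
  have [||e [ee le ex]] := Lx0 (star (s * star s0)%g).
  - by rewrite star_star.
  - by rewrite -pact_star_comp// -/(h s) hs star_star pactK.
  by exists e; split=> //; exact: natural_le_idem_star.
have [G GP] := choice (fun s => corner_term (Dk s) (germ s)).
have nG : nbhs x0 (\bigcap_(s in [set` msupp a]) G s).
  by apply: filter_bigI => s _; have [] := GP s.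
have [V [e [cV oV Vx0 VG [ee De]]]] := idempotent_bump R theta Xb Xh nG.
exists V, e; split=> //; pose c := \sum_(s <- msupp a) k s x0.
have c0 : c != 0.
  apply/eqP; rewrite /c; move: sum0; congr (_ <> _).
  by rewrite big_seq [RHS]big_seq; apply: eq_bigr => s /kx0.
have : I (delta theta e (cst c * ind R V)).
  rewrite -delta_cst_sum//; set u := delta theta e (ind R V).
  set v := \sum_(_ <- _) _.
  pose w := u ** (a ** delta theta (star s0) (ind R W)).
  suff wv : I (w - v) by apply/(ideal_subE hI wv); apply: Il; exact: Ir.
  rewrite /w /v {w v}.
  rewrite [in X in X - _](formal_sumE a) rmul_suml rmul_sumr -sumrB big_seq.
  apply: ideal_sum => // s sa; apply: NI; have [_] := GP s.
  rewrite deltaM//; apply=> // x /VG; exact.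
(* The nonzero scalar [c] is removed by multiplying with [c^-1 1_V delta_e]. *)
move=> /(Il (delta theta e (cst c^-1 * ind R V))).
rewrite deltaM; [|exact: Dideal_cst..].
rewrite skew_coef_idem//; last exact: Dideal_cst.
rewrite (ee : (e * e)%g = e); congr I; congr delta.
apply/funext => x; rewrite !fctE.
have [Vx|Vx] := pselect (V x); last by rewrite indF// !mulr0.
by rewrite indT// !mulr1 mulVf.
Qed.

(** * From one indicator in an ideal to the whole ring *)

Section FullIdeal.
Variable I : set L.
Hypotheses (hI : ideal I) (NI : N `<=` I).

Let good W e := [/\ compact W, open W,
  idempotents e /\ Dideal theta e (ind R W) & I (delta theta e (ind R W))].

(** Conjugation: the product of [1_V delta_s], [1_W delta_e] and [1_K delta_{s^*}] is
    [1_V delta_{s e s^*}] when [K] lies in [W] and [theta_{s^*}] maps [V] into [K]. *)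
Lemma covered_invariant :
  Defs.invariant theta [set x | exists W e, W x /\ good W e].
Proof.
have [_ _ Il Ir] := hI.
move=> s _ [x [[W [e [Wx [cW oW [ee De] Ie]]]] sx] <-].
have sz := pact_in sx; have s'z : pdom theta (star (star s)) (pact theta s x).
  by rewrite star_star.
have zx : pact theta (star s) (pact theta s x) = x.
  by rewrite -{2}(star_star s) pactK.
have [K [cK oK Kx KW]] : exists V, [/\ compact V, open V, V x &
    V `<=` W `&` pdom theta (star s)].
  apply: compact_open_nbhs => //; apply: filterI; apply: open_nbhs_nbhs => //.
  by split=> //; exact: pdom_open.
have [V [cV oV Vz VK]] : exists V, [/\ compact V, open V, V (pact theta s x) &
    V `<=` pdom theta s `&` pact theta (star s) @^-1` K].
  apply: compact_open_nbhs => //; apply: filterI.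
    by apply: open_nbhs_nbhs; split=> //; exact: pdom_open.
  by apply: (pact_continuous_at s'z); rewrite zx; exact: open_nbhs_nbhs.
have DK : Dideal theta (star s) (ind R K) by apply: Dideal_ind => // y /KW[].
have DV : Dideal theta s (ind R V) by apply: Dideal_ind => // y /VK[].
have WK : skew_coef theta e (ind R W) (ind R K) = ind R K.
  rewrite skew_coef_idem//; apply/funext => y; rewrite !fctE.
  have [Ky|Ky] := pselect (K y); last by rewrite (indF _ Ky) mulr0.
  by rewrite indT ?mul1r//; have [] := KW _ Ky.
have VV : skew_coef theta s (ind R V) (ind R K) = ind R V.
  apply/funext => y; rewrite skew_coefE//.
  have [Vy|Vy] := pselect (V y); last by rewrite (indF _ Vy) mul0r.
  by have [_ Ky] := VK _ Vy; rewrite [X in _ * X](indT _ Ky) mulr1.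
have DeK := skew_coef_D De DK; rewrite WK in DeK.
exists V, (s * (e * star s))%g; split=> //; split=> //.
  by split; [rewrite mulgA; exact: idem_conj|rewrite -VV; exact: skew_coef_D].
rewrite -{1}VV -deltaM// -{1}WK -deltaM//.
by apply: (Il); exact: Ir.
Qed.

(** Finitely many good sets cover a compact support. Each piece [1_W f delta_s] is in [I], because
    it agrees modulo [N] with [1_W f delta_{e s}], the product of [1_W delta_e] and [f delta_s]. *)
Lemma covered_full : (forall x, exists W e, W x /\ good W e) -> I = setT.
Proof.
move=> cov; have [_ _ _ Ir] := hI.
(* Induction on the cover: [f - 1_W f] vanishes on [W], so the remaining sets cover its support. *)
have seqI s (l : seq (set X)) : (forall W, W \in l -> exists e, good W e) ->
    forall f, Dideal theta s f ->
    (forall x, supp f x -> exists2 W, W \in l & W x) -> I (delta theta s f).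
  elim: l => [|W l IH] lg f Df fl.
    have -> : f = 0.
      apply/funext => x; apply: contrapT => fx.
      by have [W] := fl x fx.
    by rewrite delta0; have [] := hI.
  have [|e [cW oW [ee De] Ie]] := lg W; first by rewrite mem_head.
  have DW : Dideal theta s (ind R W * f).
    by apply: Dideal_mul => //; exact: ind_locally_constant.
  rewrite -(subrK (delta theta s (ind R W * f)) (delta theta s f)).
  apply: idealD => //; last first.
    apply/(ideal_delta_le hI NI (natural_le_mul_ideml s ee)).
      by rewrite -(skew_coef_idem f ee De); exact: skew_coef_D.
    by rewrite -(skew_coef_idem f ee De) -deltaM//; exact: Ir.
  rewrite -deltaB//; apply: IH => [W' W'l| |x].
  - by apply: lg; rewrite in_cons W'l orbT.
  - exact: DB.
  rewrite /supp /= !fctE; have [Wx|Wx] := pselect (W x).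
    by rewrite (indT _ Wx) mul1r subrr.
  rewrite (indF _ Wx) mul0r subr0 => /fl[W']; rewrite in_cons.
  by case/predU1P => [->//|W'l] W'x; exists W'.
apply/seteqP; split=> // a _; rewrite (formal_sumE a).
apply: ideal_sum => // s _; have Df := formal_coefP a s.
set f := a@_s in Df *.
pose Q (l : seq (set X)) := forall W, W \in l -> exists e, good W e.
(* The finite subcover comes from near covering along the filter of finite lists of good sets,
   directed by inclusion. *)
pose F := filter_from Q (fun l => [set l' | Q l' /\ {subset l <= l'}]).
have QU l l' : Q l -> Q l' -> Q (l ++ l').
  by move=> Ql Ql' W; rewrite mem_cat => /orP[/Ql|/Ql'].
have FF : Filter F.
  apply: filter_from_filter; first by exists [::].
  move=> l l' Ql Ql'; exists (l ++ l'); first exact: QU.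
  move=> m [Qm lm]; split; split=> // W Wl;
    by apply: lm; rewrite mem_cat Wl ?orbT.
have [l Ql /(_ l (conj Ql (fun _ => id)))] : F [set l | supp f `<=`
    [set x | exists2 W, W \in l & W x]].
  have /compact_near_coveringP := Df.1.2.
  move=> /(_ _ F (fun l x => exists2 W, W \in l & W x)); apply=> // x _.
  have [W [e [Wx gW]]] := cov x; have [cW oW _ _] := gW.
  exists (W, [set l' | Q l' /\ {subset [:: W] <= l'}]) => /=.
    split; first exact: open_nbhs_nbhs.
    by exists [:: W] => // W'; rewrite inE => /eqP ->; exists e.
  move=> [y l'] /= [Wy [_ Wl']]; exists W => //.
  by apply: Wl'; rewrite mem_head.
by move=> fl; exact: (seqI s l).
Qed.

(** The union of the good sets is open, invariant and nonempty, so minimality makes it all of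
    [X]. *)
Lemma minimal_full V e x : minimal_action theta -> V x -> good V e -> I = setT.
Proof.
move=> mth Vx gV; apply: covered_full => y; apply: contrapT => ny.
apply: mth; exists [set x | exists W e, W x /\ good W e]; split.
- by move=> /seteqP[+ _] => /(_ x); apply; exists V, e.
- by move=> U1; apply: ny; have : [set: X] y by []; rewrite -U1.
- rewrite openE => z [W [e' [Wz gW]]]; have [cW oW _ _] := gW.
  have : nbhs z W by exact: open_nbhs_nbhs.
  by apply: filterS => w Ww; exists W, e'.
- exact: covered_invariant.
Qed.

End FullIdeal.

Lemma formal_tau_locally_constant a : locally_constant (formal_tau a).
Proof.
rewrite /formal_tau; elim/big_ind : _ => [x|f g lf lg x|s _].
- by near=> y.
- by apply: filterS2 (lf x) (lg x) => y; rewrite !fctE => -> ->.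
- exact: (formal_coefP a s).1.1.
Unshelve. all: by end_near. Qed.

Lemma full_ideal (I : set L) a : minimal_action theta ->
    topologically_principal theta -> ideal I -> N `<=` I -> I a ->
  supp (formal_tau a) <> set0 -> I = setT.
Proof.
move=> mth pth hI NI Ia tau0; set O := supp (formal_tau a).
have oO : open O.
  rewrite openE => x Ox; apply: filterS (formal_tau_locally_constant a x) => y.
  by rewrite /O /supp /= => ->.
have /set0P O0 : O != set0 by exact/eqP.
have [x0 [Ox0 Lx0]] := pth O O0 oO.
have [V [e [cV oV Vx0 De Ie]]] := corner_idempotent hI NI Ia Lx0 Ox0.
by apply: (minimal_full hI NI mth Vx0); split; eassumption.
Qed.

End Converse.

Theorem corollary4p19 (S : inverseSemigroupType) (X : topologicalType)
    (R : fieldType) (theta : partial_action S X)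
    (S_countable : countable [set: S])
    (X_second_countable : @second_countable X)
    (X_zero_dimensional : has_compact_open_basis X)
    (X_locally_compact : locally_compact [set: X])
    (X_hausdorff : hausdorff_space X) :
  simple_rng (skew_ring theta R) <->
  [/\ minimal_action theta,
      topologically_principal theta &
      forall I : set (skew_ring theta R), ideal I -> I <> [set 0] ->
        exists2 z, I z & supp (skew_tau z) <> set0].
Proof.
have clK (z : skew_ring theta R) : skew_class (repr z) = z.
  exact: rng_class_repr.
split=> [sR|[mth pth tauI] [I [hI I0 IT]]].
  split; [exact: simple_minimal sR|exact: simple_topologically_principal sR|].
  move=> I hI I0; have [//|IT] := simple_rngP sR hI.
  (* Here [I] is the whole ring, so it suffices to take one nonzero coefficient [f] of some formal
     sum: [tau] of [f delta_s] is [f]. *)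
  have [a a0] : exists a : formal_sum theta R, a <> 0.
    apply: contrapT => /forallNP all0; apply: I0; rewrite IT.
    apply/seteqP; split=> // z _ /=; rewrite -(clK z) -(clK 0).
    by rewrite (contrapT (all0 (repr z))) (contrapT (all0 (repr 0))).
  have [s as0] : exists s, a@_s <> 0.
    apply: contrapT => /forallNP all0; apply: a0; rewrite (formal_sumE a).
    by rewrite big1// => s _; rewrite (contrapT (all0 s)) delta0.
  have Df := formal_coefP a s.
  exists (skew_class (delta theta s a@_s)); first by rewrite IT.
  rewrite skew_tauE delta_val// formal_tauU => fs; apply: as0.
  apply/funext => x; apply: contrapT => fx.
  by have : supp a@_s x by []; rewrite fs.
have [z Iz tauz] := tauI I hI I0; have [IZ IB Il Ir] := hI.
(* The preimage of [I] among formal sums, an ideal containing [N] to which [full_ideal] applies. *)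
pose J : set (formal_sum theta R) := [set a | I (skew_class a)].
have clM (a b : formal_sum theta R) :
    skew_class (a ** b) = skew_class a ** skew_class b.
  exact: rng_classM.
have cl0 : skew_class (0 : formal_sum theta R) = 0.
  by apply: (addIr (skew_class 0)); rewrite -rng_classD !add0r.
have clB (a b : formal_sum theta R) :
    skew_class (a - b) = skew_class a - skew_class b.
  by apply: (addIr (skew_class b)); rewrite -rng_classD !subrK.
have hJ : ideal J.
  split=> [|a b Ja Jb|b a Ja|b a Ja]; rewrite /J /= ?cl0 ?clB ?clM//.
  - exact: IB.
  - exact: Il.
  - exact: Ir.
have NJ : @skew_N S X theta R `<=` J.
  move=> a Na; rewrite /J /=; suff -> : skew_class a = 0 by [].
  rewrite -cl0.
  apply/(rng_classP (ideal_smallest (@skew_relator S X theta R)) a 0).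
  by rewrite subr0.
apply: IT; apply/seteqP; split=> // w _.
suff JT : J = setT.
  by rewrite -(clK w); change (J (repr w)); rewrite JT.
apply: (full_ideal X_zero_dimensional X_hausdorff mth pth hJ NJ
  (a := repr z)) => //.
by rewrite -(clK z) in Iz.
Qed.
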